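(* Let $\alpha,\beta,\gamma$ be nonzero ordinals and let $\lambda,\nu$ be nonzero cardinals. Let $X$ be a nonempty set and $\tau$ a nonempty family of subsets of $X$. The following implications hold for $(X,\tau)$. (1) If $\beta\le\alpha$ and $\alpha$ is infinite, then $[\beta,\alpha]$-compactness implies $[\beta,\alpha+1]$-compactness, hence also $[\beta,\alpha+n]$-compactness for each $n<\omega$. (2) If either $\gamma$ or $\alpha$ is infinite, then $[\gamma+\alpha,\gamma+\alpha]$-compactness implies $[\gamma+\alpha+\alpha,\gamma+\alpha+\alpha]$-compactness, hence also $[\gamma+\alpha\cdot n,\gamma+\alpha\cdot n]$-compactness for each $n$ with $1\le n<\omega$. (3) If $\beta\le\alpha$, $\alpha$ is infinite, and $\lambda=\operatorname{cf}\alpha$, then $[\beta,\alpha]$-compactness implies $[\beta,\alpha+\lambda\cdot\omega)$-compactness. (4) If $\beta\le\lambda$, then $[\beta,\lambda]$-compactness implies $[\beta,\lambda^+)$-compactness. (5) If $\beta\le\alpha+\lambda$, and either $\operatorname{cf}\alpha>\lambda$, or $\alpha$ can be written as a limit of ordinals of cofinality $>\lambda$, then $[\beta,\alpha+\lambda]$-compactness implies $[\beta,\alpha+\lambda^+)$-compactness. Suppose further that $\tau$ is closed under arbitrary unions. Then: (6) $[\alpha,\alpha]$-compactness implies $[\beta+\alpha,\beta+\alpha]$-compactness. (7) $[\alpha,\alpha]$-compactness implies $[\beta\cdot\alpha,\beta\cdot\alpha]$-compactness. (8) If $\operatorname{cf}\alpha=\nu$ is infinite, then $[\nu,\nu]$-compactness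 implies $[\alpha,\alpha]$-compactness.
   Context: For a nonempty set $X$, a nonempty family $\tau$ of subsets of $X$ (not necessarily a topology) and nonzero ordinals $\alpha,\beta$, $(X,\tau)$ is $[\beta,\alpha]$-compact if, whenever $(O_\delta)_{\delta\in\alpha}$ is a sequence of members of $\tau$ (repetitions allowed) with $\bigcup_{\delta\in\alpha}O_\delta=X$, there is $H\subseteq\alpha$ of order type $<\beta$ (in the induced order) with $\bigcup_{\delta\in H}O_\delta=X$. $(X,\tau)$ is $[\beta,\alpha)$-compact if it is $[\beta,\alpha']$-compact for every nonzero $\alpha'<\alpha$. The operations $+$ and $\cdot$ are ordinal sum and product; cardinals are identified with initial ordinals; $\lambda^+$ is the successor cardinal of $\lambda$; successor ordinals have cofinality $1$; the Axiom of Choice is assumed. *)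

(* Defs.v *)
From mathcomp Require Import all_boot.
From mathcomp Require Import boolp classical_sets functions cardinality.
From mathcomp Require Import wochoice.

Set Implicit Arguments.
Unset Strict Implicit.
Unset Printing Implicit Defensive.

Local Open Scope classical_set_scope.
Local Open Scope card_scope.

(** An ordinal is represented by a well-ordered type; equality of ordinals is
    the isomorphism relation [ord_eq], and every notion below is invariant
    under it. The elements of the carrier play the role of the smaller
    ordinals. *)
Record Ord := MkOrd {
  ord_sort :> Type;
  ole : rel ord_sort;
  ole_wo : well_order ole }.

Definition olt (a : Ord) (x y : a) : bool := ~~ ole y x.

Section WellOrder.
Variables (T : Type) (R : rel T).

Lemma well_order_of_min :
    antisymmetric R ->
    (forall A : set T, A !=set0 -> exists2 z, A z & forall x, A x -> R z x) ->
  well_order R.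
Proof.
move=> Ranti Rmin; apply: antisymmetric_well_order => // A [x Ax].
by have [|z Az zmin] := Rmin [set y | y \in A]; [exists x | exists z].
Qed.

Hypothesis Rwo : well_order R.

Lemma wo_min (A : set T) :
  A !=set0 -> exists2 z, A z & forall x, A x -> R z x.
Proof.
move=> [x Ax]; have [|z [[/asboolP Az zmin] _]] := Rwo (A := fun y => `[<A y>]).
  by exists x; apply/asboolP.
by exists z => // y Ay; apply: zmin; apply/asboolP.
Qed.

Lemma wo_total : total R.
Proof.
move=> x y; have [|z [->|->] zmin] := @wo_min [set z | z = x \/ z = y].
- by exists x; left.
- by rewrite zmin//; right.
- by rewrite [R y x]zmin ?orbT//; left.
Qed.

Lemma wo_refl : reflexive R.
Proof. by move=> x; have := wo_total x x; rewrite orbb. Qed.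

Lemma wo_anti : antisymmetric R.
Proof.
move=> x y /andP[Rxy Ryx].
have [|z [_ Uz]] := Rwo (A := fun z => `[<z = x \/ z = y>]).
  by exists x; apply/asboolP; left.
rewrite -(Uz x) ?(Uz y)//; split; try by apply/asboolP; auto.
- by move=> t /asboolP[->|->]//; rewrite wo_refl.
- by move=> t /asboolP[->|->]//; rewrite wo_refl.
Qed.

Lemma wo_trans : transitive R.
Proof.
move=> y x z Rxy Ryz.
have [|t] := @wo_min [set t | t = x \/ t = y \/ t = z]; first by exists x; left.
move=> [->|[->|->]] tmin.
- by apply: tmin; right; right.
- by have -> : x = y by apply: wo_anti; rewrite Rxy tmin//; left.
- have Rzx : R z x by apply: tmin; left.
  have Rzy : R z y by apply: tmin; right; left.
  by have <- : y = z by apply: wo_anti; rewrite Ryz Rzy.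
Qed.

End WellOrder.

Lemma ole_refl (a : Ord) (x : a) : ole x x.
Proof. by apply: wo_refl; exact: ole_wo. Qed.

Section SubOrdinal.
Variables (a : Ord) (H : set a).

Definition sub_le : rel {x : a | x \in H} := fun x y => ole (val x) (val y).

Lemma sub_le_wo : well_order sub_le.
Proof.
apply: well_order_of_min => [x y /(wo_anti (@ole_wo a))/val_inj//|A [x Ax]].
have [|_ [z Az <-] zmin] := wo_min (@ole_wo a) (A := val @` A).
  by exists (val x), x.
by exists z => // y Ay; apply: zmin; exists y.
Qed.

(** The order type of [H] in the order induced by [a]. *)
Definition otp : Ord := MkOrd sub_le_wo.

End SubOrdinal.

Section Arithmetic.
Variables a b : Ord.

Definition sum_le : rel (a + b) := fun x y =>
  match x, y with
  | inl x, inl y => ole x y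
  | inl _, inr _ => true
  | inr _, inl _ => false
  | inr x, inr y => ole x y
  end.

Lemma sum_le_wo : well_order sum_le.
Proof.
apply: well_order_of_min => [|A [x0 Ax0]].
  move=> [x|x] [y|y] //= /andP[xy yx]; last first.
    by congr inr; apply: (wo_anti (@ole_wo b)); rewrite xy yx.
  by congr inl; apply: (wo_anti (@ole_wo a)); rewrite xy yx.
have [AN0|A0] := pselect ((inl : a -> a + b) @^-1` A !=set0).
  have [z Az zmin] := wo_min (@ole_wo a) AN0.
  by exists (inl z) => // -[x|x] //=; apply: zmin.
have [|z Az zmin] := wo_min (@ole_wo b) (A := (inr : b -> a + b) @^-1` A).
  by case: x0 Ax0 => [x Ax|x Ax]; [case: A0; exists x | exists x].
by exists (inr z) => // -[x|x] /= Ax; [case: A0; exists x | apply: zmin].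
Qed.

Definition ord_add : Ord := MkOrd sum_le_wo.

(** [b] consecutive copies of [a]: the second component dominates. *)
Definition prod_le : rel (a * b) := fun x y =>
  ole x.2 y.2 && (ole y.2 x.2 ==> ole x.1 y.1).

Lemma prod_le_wo : well_order prod_le.
Proof.
apply: well_order_of_min => [[x1 x2] [y1 y2]|A [x0 Ax0]].
  rewrite /prod_le/= => /andP[/andP[xy2 xy1] /andP[yx2 yx1]].
  congr pair; last by apply: (wo_anti (@ole_wo b)); rewrite xy2.
  by apply: (wo_anti (@ole_wo a)); rewrite (implyP xy1)// (implyP yx1).
have [|_ [[z1 z2] Az <-] z2min] := wo_min (@ole_wo b) (A := snd @` A).
  by exists x0.2, x0.
have [|t1 At t1min] := wo_min (@ole_wo a) (A := [set t | A (t, z2)]).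
  by exists z1.
exists (t1, z2) => // -[x1 x2] Ax; rewrite /prod_le/= (z2min x2); last first.
  by exists (x1, x2).
apply/implyP => /= x2z2; apply: t1min => /=.
suff <- : x2 = z2 by [].
apply: (wo_anti (@ole_wo b)); rewrite x2z2 /=.
by apply: (z2min x2); exists (x1, x2).
Qed.

Definition ord_mul : Ord := MkOrd prod_le_wo.

End Arithmetic.

Lemma leq_wo : well_order leq.
Proof.
apply: well_order_of_min => [|A [n An]]; first exact: anti_leq.
have exA : exists n, `[<A n>] by exists n; apply/asboolP.
case: (ex_minnP exA) => m /asboolP Am mmin.
by exists m => // k Ak; apply/mmin/asboolP.
Qed.

Definition omega : Ord := MkOrd leq_wo.

Definition ord_nat (n : nat) : Ord := otp (a := omega) [set k | k < n].

Definition ord_eq (a b : Ord) :=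
  exists2 f : a -> b, {mono f : x y / ole x y} & range f = setT.

Definition ord_lt (a b : Ord) :=
  exists2 f : a -> b, {mono f : x y / ole x y} &
    exists x : b, range f = [set y | olt y x].

Definition ord_le (a b : Ord) := ord_lt a b \/ ord_eq a b.

Definition nonzero (a : Ord) := [set: a] !=set0.

Definition infinite (a : Ord) := infinite_set [set: a].

Declare Scope ordinal_scope.
Delimit Scope ordinal_scope with ordinal.
Bind Scope ordinal_scope with Ord.
Notation "a + b" := (ord_add a b) : ordinal_scope.
Notation "a * b" := (ord_mul a b) : ordinal_scope.
Notation "n %:o" := (ord_nat n) (at level 2, format "n %:o") : ordinal_scope.
Notation "a =o b" := (ord_eq a b) (at level 70) : ordinal_scope.
Notation "a <o b" := (ord_lt a b) (at level 70) : ordinal_scope.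
Notation "a <=o b" := (ord_le a b) (at level 70) : ordinal_scope.
Local Open Scope ordinal_scope.

Section InitialEmbedding.

Definition initial_emb (a b : Ord) (f : a -> b) :=
  {mono f : x y / ole x y} /\ forall x y, ole y (f x) -> range f y.

Lemma ole_olt (a : Ord) (x y : a) : olt x y -> ole x y.
Proof. by rewrite /olt => /negPf xy; have := wo_total (@ole_wo a) x y; rewrite xy orbF. Qed.

Lemma ole_lt_trans (a : Ord) (x y z : a) : ole x y -> olt y z -> olt x z.
Proof. by move=> xy; apply: contra => /(wo_trans (@ole_wo a)); apply. Qed.

Lemma oltxx (a : Ord) (x : a) : olt x x = false.
Proof. by rewrite /olt ole_refl. Qed.

Lemma ole_eqVlt (a : Ord) (x y : a) : ole x y -> x = y \/ olt x y.
Proof.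
move=> xy; have [yx|] := boolP (ole y x); last by right.
by left; apply: (wo_anti (@ole_wo a)); rewrite xy.
Qed.

Lemma mono_lt (a b : Ord) (f : a -> b) :
  {mono f : x y / ole x y} -> {mono f : x y / olt x y}.
Proof. by move=> fm x y; rewrite /olt fm. Qed.

Lemma mono_ole_inj (a b : Ord) (f : a -> b) :
  {mono f : x y / ole x y} -> injective f.
Proof.
move=> fm x y fxy; apply: (wo_anti (@ole_wo a)).
by rewrite -!fm fxy ole_refl.
Qed.

Lemma initial_emb_uniq (a b : Ord) (f g : a -> b) :
  initial_emb f -> initial_emb g -> f =1 g.
Proof.
move=> [fm fi] [gm gi] x; apply: contrapT => fgx.
have [|z fgz zmin] := wo_min (@ole_wo a) (A := [set z | f z <> g z]).
  by exists x.
have eqlt t : olt t z -> f t = g t.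
  by move=> /negP tz; apply: contrapT => /zmin.
have [gf|fg] : olt (g z) (f z) \/ olt (f z) (g z).
- have /orP[|] := wo_total (@ole_wo b) (f z) (g z).
  + by move=> /ole_eqVlt[//|]; right.
  + by move=> /ole_eqVlt[/esym//|]; left.
- have [t _ ft] := fi _ _ (ole_olt gf).
  have tz : olt t z by rewrite -(mono_lt fm) ft.
  by move: ft; rewrite eqlt// => /(mono_ole_inj gm) tE; rewrite tE oltxx in tz.
- have [t _ gt] := gi _ _ (ole_olt fg).
  have tz : olt t z by rewrite -(mono_lt gm) gt.
  by move: gt; rewrite -eqlt// => /(mono_ole_inj fm) tE; rewrite tE oltxx in tz.
Qed.

Lemma ord_lt_emb (a b : Ord) (f : a -> b) x :
  {mono f : x y / ole x y} -> range f = [set y | olt y x] -> initial_emb f.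
Proof.
move=> fm fr; split=> // t y yt; rewrite fr /=.
by apply: (ole_lt_trans yt); have : range f (f t) by []; rewrite fr.
Qed.

Lemma ord_leP (a b : Ord) :
  a <=o b <-> exists f : a -> b, initial_emb f.
Proof.
split=> [[[f fm [x fr]]|[f fm fr]]|[f [fm fi]]].
- by exists f; apply: ord_lt_emb fr.
- by exists f; split=> // x y _; rewrite fr.
- have [fr|/existsNP[y0 fy0]] := pselect (forall y, range f y).
    by right; exists f => //; apply/seteqP; split.
  left; exists f => //.
  have [|x fx xmin] := wo_min (@ole_wo b) (A := ~` range f); first by exists y0.
  exists x; apply/seteqP; split=> [_ [t _ <-] /=|y /= yx].
    by apply/negP => /fi.
  by apply: contrapT => /xmin; apply/negP.
Qed.

Lemma initial_emb_comp (a b c : Ord) (f : a -> b) (g : b -> c) :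
  initial_emb f -> initial_emb g -> initial_emb (g \o f).
Proof.
move=> [fm fi] [gm gi]; split=> [x y|x y /= yx]; first by rewrite /= gm fm.
have [t _ gt] := gi _ _ yx; move: yx; rewrite -gt gm => /fi[s _ <-].
by exists s.
Qed.

Lemma ord_lt_le_irrefl (a b : Ord) : a <o b -> ~ b <=o a.
Proof.
move=> [f fm [x fr]] /ord_leP[g gi].
have fgi := initial_emb_comp gi (ord_lt_emb fm fr).
have idi : initial_emb (@id b) by split=> // t y _; exists y.
have : range f (f (g x)) by exists (g x).
by rewrite (initial_emb_uniq fgi idi x : f (g x) = x) fr /= oltxx.
Qed.

Lemma ord_le_of_segments (a b : Ord) :
  (forall x : a, otp [set y | olt y x] <o b) -> a <=o b.
Proof.
move=> seg.
have {}seg (x : a) : exists y : b, exists2 f : otp [set y | olt y x] -> b,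
    {mono f : x y / ole x y} & range f = [set z | olt z y].
  by have [f fm [y fr]] := seg x; exists y, f.
have [g gP] := choice seg; apply/ord_leP; exists g.
have key (x z : a) (f : otp [set y | olt y x] -> b) (zx : z \in [set y | olt y x]) :
    {mono f : x y / ole x y} -> range f = [set z | olt z (g x)] ->
  g z = f (SigSub zx).
  move=> fm fr; have [h hm hr] := gP z.
  have lift (t : otp [set y | olt y z]) : val t \in [set y | olt y x].
    apply/mem_set; apply: ole_lt_trans (ole_olt (set_mem (valP t))) _.
    exact: set_mem zx.
  pose f' (t : otp [set y | olt y z]) := f (SigSub (lift t)).
  have f'm : {mono f' : x y / ole x y} by move=> t s; rewrite fm.
  have f'r : range f' = [set y | olt y (f (SigSub zx))].
    apply/seteqP; split=> [_ [t _ <-]|y /= yz] /=.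
      by rewrite (mono_lt fm) /olt/=; exact: set_mem (valP t).
    have [s _ sy] : range f y.
      rewrite fr /=; apply: (ole_lt_trans (ole_olt yz)).
      by have : range f (f (SigSub zx)) by []; rewrite fr.
    have sz : olt (val s) z by move: yz; rewrite -sy (mono_lt fm).
    exists (SigSub (mem_set sz : val s \in [set y | olt y z])) => //.
    by rewrite -sy; congr f; exact: val_inj.
  have hf := initial_emb_uniq (ord_lt_emb hm hr) (ord_lt_emb f'm f'r).
  have rE : range h = range f'.
    by apply/seteqP; split=> _ [t _ <-]; exists t => //; rewrite hf.
  have e : [set y | olt y (g z)] = [set y | olt y (f (SigSub zx))].
    by rewrite -hr rE f'r.
  apply: (wo_anti (@ole_wo b)); apply/andP; split; rewrite -[ole _ _]negbK.
  - apply/negP => lt; have : [set y | olt y (g z)] (f (SigSub zx)) by [].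
    by rewrite e /= oltxx.
  - apply/negP => lt.
    have : [set y | olt y (f (SigSub zx))] (g z) by [].
    by rewrite -e /= oltxx.
have glt (z x : a) : olt z x -> olt (g z) (g x).
  move=> zx; have [f fm fr] := gP x.
  rewrite (key x z f (mem_set zx) fm fr).
  by have : range f (f (SigSub (mem_set zx : z \in [set y | olt y x]))) by [];
    rewrite fr.
split=> [x z|x y /ole_eqVlt[->|yx]]; last 2 first.
- by exists x.
- have [f fm fr] := gP x.
  have [t _ ty] : range f y by rewrite fr.
  exists (val t) => //; rewrite (key x (val t) f (valP t) fm fr) -ty.
  by congr f; exact: val_inj.
apply/idP/idP => [gxz|/ole_eqVlt[->|/glt/ole_olt//]].
  by rewrite -[ole _ _]negbK; apply/negP => /glt; rewrite /olt gxz.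
by rewrite ole_refl.
Qed.

Lemma ord_le_total (a b : Ord) : a <=o b \/ b <o a.
Proof.
have [/ord_le_of_segments|/existsNP[x0 x0P]] :=
  pselect (forall x : a, otp [set y | olt y x] <o b); first by left.
right.
have [|x xP xmin] := wo_min (@ole_wo a)
  (A := [set x | ~ otp [set y | olt y x] <o b]); first by exists x0.
have : otp [set y | olt y x] <=o b.
  apply: ord_le_of_segments => t.
  have [f fm [y fr]] : otp [set y | olt y (val t)] <o b.
    apply: contrapT => /xmin; apply/negP; exact: set_mem (valP t).
  have down (s : otp [set y : otp [set y | olt y x] | olt y t]) :
      val (val s) \in [set y | olt y (val t)].
    by apply/mem_set; exact: (set_mem (valP s)).
  exists (fun s => f (SigSub (down s))); first by move=> s s'; rewrite fm.
  exists y; rewrite -fr; apply/seteqP; split=> _ [s _ <-].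
    by exists (SigSub (down s)).
  have sx : val s \in [set y | olt y x].
    apply/mem_set/(ole_lt_trans (ole_olt (set_mem (valP s)))).
    exact: set_mem (valP t).
  have st : (SigSub sx : otp [set y | olt y x]) \in [set y | olt y t].
    by apply/mem_set; exact: (set_mem (valP s)).
  by exists (SigSub st) => //; congr f; exact: val_inj.
move=> [//|[f fm fr]].
have g y : exists t, f t = y by have : range f y by [rewrite fr]; case=> t; exists t.
have [h hK] := choice g.
exists (val \o h); first by move=> y z /=; rewrite -{2}(hK y) -{2}(hK z) fm.
exists x; apply/seteqP; split=> [_ [y _ <-]|z /= zx] /=.
  exact: set_mem (valP (h y)).
exists (f (SigSub (mem_set zx : z \in [set y | olt y x]))) => //=.
by rewrite (mono_ole_inj fm (hK _)).
Qed.

Lemma ex_ord_least (P : Ord -> Prop) :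
  (exists a, P a) -> exists a, P a /\ forall b, P b -> a <=o b.
Proof.
move=> [a0 Pa0].
pose A := [set x : a0 | exists2 b, P b & exists2 f : b -> a0,
  {mono f : x y / ole x y} & range f = [set y | olt y x]].
have [AN0|A0] := pselect (A !=set0); last first.
  exists a0; split=> // b Pb; have [//|[f fm [x fr]]] := ord_le_total a0 b.
  by case: A0; exists x, b => //; exists f.
have [x [b Pb [f fm fr]] xmin] := wo_min (@ole_wo a0) AN0.
exists b; split=> // c Pc; have [//|[g gm [y gr]]] := ord_le_total b c.
have fyx : olt (f y) x by have : range f (f y) by []; rewrite fr.
suff /xmin : A (f y) by move=> xfy; rewrite /olt xfy in fyx.
exists c => //; exists (f \o g); first by move=> s t; rewrite /= fm gm.
apply/seteqP; split=> [_ [s _ <-]|z /= zfy] /=.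
  by rewrite (mono_lt fm); have : range g (g s) by []; rewrite gr.
have [t _ ft] : range f z.
  by rewrite fr /=; exact: ole_lt_trans (ole_olt zfy) fyx.
have [s _ gs] : range g t by rewrite gr /= -(mono_lt fm) ft.
by exists s => //=; rewrite gs.
Qed.

End InitialEmbedding.

Definition ord_least (P : Ord -> Prop) (P0 : exists a, P a) : Ord :=
  sval (cid (ex_ord_least P0)).

Definition cofinal (a : Ord) (H : set a) :=
  forall x : a, exists2 y, H y & ole x y.

(* Classes of ordinals are plain predicates rather than [set]s, so as not to
   force the universe of [set] above the one of [Ord]. *)
Definition cofinal_type (a k : Ord) :=
  exists2 H : set a, cofinal H & k = otp H.

Lemma ex_cofinal_type (a : Ord) : exists k, cofinal_type a k.
Proof.
exists (otp [set: a]), setT => // x; exists x => //.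
by rewrite ole_refl.
Qed.

Definition cf (a : Ord) : Ord := ord_least (ex_cofinal_type a).

(** Cardinals are the initial ordinals. *)
Definition cardinal (l : Ord) :=
  forall a : Ord, a <o l -> [set: a] #!= [set: l].

Lemma ex_larger_cardinal (l : Ord) : exists k, cardinal k /\ l <o k.
Proof.
have [R Rwo] := well_ordering_principle {classic (l -> Prop)}.
pose w := MkOrd Rwo.
have [|k [kw kmin]] := @ex_ord_least (fun k => [set: k] #= [set: w]).
  by exists w; exact: card_eqxx.
exists k; split=> [a ak|].
  apply/negP => alk; apply: (ord_lt_le_irrefl ak); apply: kmin.
  exact: card_eq_trans alk kw.
have [/ord_leP[g [gm _]]|//] := ord_le_total k l.
have /card_bijP[h [h' _ hK]] := kw.
have inT (T : Type) (x : T) : x \in [set: T] by exact: mem_set.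
pose F x : l -> Prop := val (h (SigSub (inT k x))).
pose D : l -> Prop := fun y => exists2 x : k, g x = y & ~ F x y.
pose x := val (h' (SigSub (inT w D))).
have FD : F x = D.
  rewrite /F; have -> : SigSub (inT k x) = h' (SigSub (inT w D)) by exact: val_inj.
  by rewrite hK.
have nD : ~ D (g x).
  move=> [y /(mono_ole_inj gm) ->]; rewrite FD => nD.
  by apply: (nD); exists x; rewrite ?FD.
by case: (nD); exists x; rewrite ?FD.
Qed.

Definition succ_card (l : Ord) : Ord :=
  ord_least (ex_larger_cardinal l).

(** [a] is the strict supremum of the class [A] of ordinals smaller than [a]; for
    nonzero [a] this forces [a] to be a limit ordinal. *)
Definition limit_of (A : Ord -> Prop) (a : Ord) :=
  (forall d, A d -> d <o a) /\
  (forall c, c <o a -> exists2 d, A d & c <o d).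

Section Compactness.
Variables (X : Type) (tau : set (set X)).

(** Closed-bracket compactness [b, a]. *)
Definition ord_compact (b a : Ord) :=
  forall O : a -> set X, (forall d, tau (O d)) -> \bigcup_d O d = setT ->
  exists2 H : set a, otp H <o b & \bigcup_(d in H) O d = setT.

(** Half-open compactness [b, a). *)
Definition ord_compact_below (b a : Ord) :=
  forall c, nonzero c -> c <o a -> ord_compact b c.

Definition union_closed :=
  forall F : set (set X), F `<=` tau -> tau (\bigcup_(U in F) U).

End Compactness.

(* Main.v *)
Require Import Defs.
From mathcomp Require Import all_boot.
From mathcomp Require Import boolp classical_sets functions cardinality.
From Corelib Require Import Setoid Morphisms.

(** Compactness is transferred along surjections [r : alpha -> kappa]: a cover
    of length [kappa] composed with [r] is a cover of length [alpha], so it has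
    a subcover indexed by a small [H], and the original cover has a subcover
    indexed by the image of [H] ([compact_reindex]). A subcover of type at most
    [alpha] can be shrunk again below [beta] ([compact_shrink]). So, to pass
    from [[beta, alpha]] to [[beta, alpha']], it suffices to shorten covers of
    each type [kappa] with [alpha < kappa <= alpha'] to some type below [kappa]
    ([compact_descent]), that is, to find an [r] whose images of sets of type
    less than [alpha] have type less than [kappa].

    For (1), [r] comes from [1 + alpha = alpha]. For (2) and (3) the point is
    that [l = 2 * l] for a limit [l], so that [l] maps onto two copies of itself
    in an order-preserving way on each ([limit_split]). What is missing from a
    small set of indices must not be absorbed when [l] is replaced by a longer
    block ([compact_insert]); this rests on the purely arithmetic
    [ord_ltD_tail]. In (2), the limit part of [alpha] is doubled. In (3), the
    doubled block is the least nonzero tail [rho] of [alpha]: it is additively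
    indecomposable, so every length between [alpha] and [alpha + rho] can be
    reached, and it is at least [cf alpha], so finitely many steps
    reach every ordinal below [alpha + cf alpha * omega].

    In (4) and (5), [r] is an arbitrary map from [lambda] onto an ordinal below
    [lambda^+], and images of small sets are bounded by their cardinality; the
    hypotheses of (5) ensure that [h + delta < alpha] for [h < alpha] and
    [delta < lambda^+] ([cf_closed]). In (6), (7) and (8), several members of
    the cover are replaced by their union ([compact_gather]). *)

Set Implicit Arguments.
Unset Strict Implicit.
Unset Printing Implicit Defensive.

Local Open Scope classical_set_scope.
Local Open Scope ordinal_scope.

(** * The order of ordinals *)

Lemma olt_le_trans (a : Ord) (x y z : a) : olt x y -> ole y z -> olt x z.
Proof. by move=> xy yz; apply: contra xy; exact: (wo_trans (@ole_wo a)). Qed.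

Lemma ole_ltP (a : Ord) (x y : a) : ole x y \/ olt y x.
Proof. by rewrite /olt; case: (ole x y); [left | right]. Qed.

(** Orders being total, preserving the strict order on [H] also reflects it. *)
Lemma olt_mono (a b : Ord) (H : set a) (f : a -> b) :
    (forall x y, H x -> H y -> olt x y -> olt (f x) (f y)) ->
  forall x y, H x -> H y -> ole (f x) (f y) = ole x y.
Proof.
move=> fh x y Hx Hy; apply/idP/idP => [fxy|/ole_eqVlt[->|/fh]]; last 2 first.
- exact: ole_refl.
- by move=> /(_ Hx Hy)/ole_olt.
- by have [//|/fh] := ole_ltP x y; rewrite /olt fxy => /(_ Hy Hx).
Qed.

(** An order embedding need not be initial. Were [b] shorter than [a], it would
    yield a strictly increasing self-map of [a] sending every point below
    itself, and the least point moved down would move down once more. This is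
    the main tool for comparing order types. *)
Lemma mono_ord_le (a b : Ord) (f : a -> b) :
  {mono f : x y / ole x y} -> a <=o b.
Proof.
move=> fm; have [//|[g gm [x gr]]] := ord_le_total a b.
pose h := g \o f.
have hm : {mono h : x y / olt x y} by apply: mono_lt => y z; rewrite /= gm fm.
have hx : olt (h x) x by have : range g (h x) by [exists (f x)]; rewrite gr.
have [|z hz zmin] := wo_min (@ole_wo a) (A := [set z | olt (h z) z]).
  by exists x.
by have := zmin (h z); rewrite /= hm => /(_ hz) zh; move: hz; rewrite /= /olt zh.
Qed.

Lemma ord_lexx (a : Ord) : a <=o a.
Proof. exact: (@mono_ord_le _ _ id). Qed.

Lemma ord_le_trans (b a c : Ord) : a <=o b -> b <=o c -> a <=o c.
Proof.
move=> /ord_leP[f fi] /ord_leP[g gi]; apply/ord_leP.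
by exists (g \o f); exact: initial_emb_comp.
Qed.

Lemma ord_ltW (a b : Ord) : a <o b -> a <=o b.
Proof. by left. Qed.

Lemma ord_leNgt (a b : Ord) : a <=o b <-> ~ b <o a.
Proof.
split=> [ab ba|nba]; first exact: ord_lt_le_irrefl ba ab.
by have [|/nba] := ord_le_total a b.
Qed.

Lemma ord_ltNge (a b : Ord) : a <o b <-> ~ b <=o a.
Proof.
split=> [ab ba|nba]; first exact: ord_lt_le_irrefl ab ba.
by have [/nba|] := ord_le_total b a.
Qed.

Lemma ord_ltxx (a : Ord) : ~ a <o a.
Proof. by move=> aa; exact: ord_lt_le_irrefl aa (ord_lexx a). Qed.

Lemma ord_lt_le_trans (b a c : Ord) : a <o b -> b <=o c -> a <o c.
Proof.
move=> ab bc; apply/ord_ltNge => ca.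
by apply: (ord_lt_le_irrefl ab); exact: ord_le_trans ca.
Qed.

Lemma ord_le_lt_trans (b a c : Ord) : a <=o b -> b <o c -> a <o c.
Proof.
move=> ab bc; apply/ord_ltNge => ca.
by apply: (ord_lt_le_irrefl bc); exact: ord_le_trans ab.
Qed.

Lemma ord_lt_trans (b a c : Ord) : a <o b -> b <o c -> a <o c.
Proof. by move=> ab /ord_ltW; exact: ord_lt_le_trans. Qed.

Lemma ord_le_anti (a b : Ord) : a <=o b -> b <=o a -> a =o b.
Proof. by move=> [/ord_lt_le_irrefl|]. Qed.

Lemma ord_eq_bij (a b : Ord) : a =o b -> exists (f : a -> b) (g : b -> a),
  [/\ {mono f : x y / ole x y}, {mono g : x y / ole x y},
      cancel f g & cancel g f].
Proof.
move=> [f fm fr].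
have g y : exists t, f t = y by have : range f y by [rewrite fr]; case=> t; exists t.
have [h hK] := choice g; exists f, h; split=> //.
- by move=> x y; rewrite -fm !hK.
- by move=> x; apply: (mono_ole_inj fm); rewrite hK.
Qed.

Lemma ord_eq_le (a b : Ord) : a =o b -> a <=o b.
Proof. by right. Qed.

Lemma ord_eq_ge (a b : Ord) : a =o b -> b <=o a.
Proof. by move=> /ord_eq_bij[f [g [_ gm _ _]]]; exact: mono_ord_le gm. Qed.

Lemma ord_eq_refl (a : Ord) : a =o a.
Proof. by apply: ord_le_anti; exact: ord_lexx. Qed.

Lemma ord_eq_sym (a b : Ord) : a =o b -> b =o a.
Proof. by move=> ab; apply: ord_le_anti; [exact: ord_eq_ge | right]. Qed.

Lemma ord_eq_trans (a b c : Ord) : a =o b -> b =o c -> a =o c.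
Proof.
move=> ab bc; apply: ord_le_anti; apply: (@ord_le_trans b).
- exact: ord_eq_le.
- exact: ord_eq_le.
- exact: ord_eq_ge.
- exact: ord_eq_ge.
Qed.

#[local] Hint Resolve ord_lexx ord_eq_refl : core.

#[global] Instance ord_eq_equivalence : Equivalence ord_eq.
Proof.
split; [exact: ord_eq_refl | exact: ord_eq_sym | exact: ord_eq_trans].
Qed.

#[global] Instance ord_le_proper : Proper (ord_eq ==> ord_eq ==> iff) ord_le.
Proof.
move=> a a' aa b b' bb; split=> ab.
- exact: ord_le_trans (ord_eq_ge aa) (ord_le_trans ab (ord_eq_le bb)).
- exact: ord_le_trans (ord_eq_le aa) (ord_le_trans ab (ord_eq_ge bb)).
Qed.

#[global] Instance ord_lt_proper : Proper (ord_eq ==> ord_eq ==> iff) ord_lt.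
Proof. by move=> a a' aa b b' bb; rewrite !ord_ltNge aa bb. Qed.

(** Induction on ordinals themselves, which spares transporting statements
    along the elements of a fixed well-order. *)
Lemma ord_least_ind (P : Ord -> Prop) :
  (forall a, (forall b, b <o a -> P b) -> P a) -> forall a, P a.
Proof.
move=> IH a; apply: contrapT => nPa.
have [|b [nPb bmin]] := @ex_ord_least (fun b => ~ P b); first by exists a.
by apply/nPb/IH => c cb; apply: contrapT => /bmin/ord_leNgt.
Qed.

Lemma nonzero_le (a b : Ord) : a <=o b -> nonzero a -> nonzero b.
Proof. by move=> /ord_leP[f _] [x _]; exists (f x). Qed.

Lemma infinite_le (a b : Ord) : a <=o b -> infinite a -> infinite b.
Proof.
move=> /ord_leP[f [fm _]]; apply: contra_not => finb.
apply: (sub_finite_set (B := f @^-1` setT)) => //.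
by apply: finite_preimage => // x y _ _; exact: mono_ole_inj.
Qed.

(** * Order types of subsets *)

Definition otp_elt (a : Ord) (H : set a) (x : a) (Hx : H x) : otp H :=
  exist _ x (mem_set Hx).

Lemma otp_eltP (a : Ord) (H : set a) (u : otp H) : H (val u).
Proof. exact: set_mem (valP u). Qed.

Lemma otp_map (a b : Ord) (H : set a) (K : set b) (g : a -> b) :
    (forall x, H x -> K (g x)) ->
    (forall x y, H x -> H y -> ole (g x) (g y) = ole x y) ->
  otp H <=o otp K.
Proof.
move=> gK gm; apply: (@mono_ord_le _ _ (fun u => otp_elt (gK _ (otp_eltP u)))).
by move=> u v; apply: gm; exact: otp_eltP.
Qed.

Lemma otp_sub (a : Ord) (H K : set a) : H `<=` K -> otp H <=o otp K.
Proof. by move=> HK; exact: (@otp_map _ _ _ _ id). Qed.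

Lemma otp_setT (a : Ord) : otp [set: a] =o a.
Proof.
exists val => //; apply/seteqP; split=> // x _.
by exists (@otp_elt _ [set: a] x I).
Qed.

Lemma otp_le (a : Ord) (H : set a) : otp H <=o a.
Proof. exact: (@mono_ord_le (otp H) a (fun u => val u) (fun _ _ => erefl)). Qed.

Lemma otp_image (a b : Ord) (f : a -> b) (H : set a) :
    (forall x y, H x -> H y -> ole (f x) (f y) = ole x y) ->
  otp (f @` H) =o otp H.
Proof.
move=> fm; apply: ord_le_anti; last first.
  by apply: (@otp_map _ _ _ _ f) => // x Hx; exists x.
have pre (u : otp (f @` H)) : exists x : otp H, f (val x) = val u.
  by have [x Hx fx] := otp_eltP u; exists (otp_elt Hx).
have [g gP] := choice pre.
apply: (@mono_ord_le _ _ g) => u v.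
by rewrite /= /sub_le -fm ?gP//; exact: otp_eltP.
Qed.

Definition seg (a : Ord) (x : a) : Ord := otp [set y | olt y x].
Definition tail (a : Ord) (x : a) : Ord := otp [set y | ole x y].

Lemma seg_lt (a : Ord) (x : a) : seg x <o a.
Proof.
exists val => //; exists x; apply/seteqP; split=> [_ [u _ <-]|y yx].
  exact: otp_eltP u.
by exists (otp_elt yx).
Qed.

Lemma ord_ltP (a b : Ord) : a <o b -> exists x : b, a =o seg x.
Proof.
move=> [f fm [x fr]]; exists x; rewrite /seg -fr.
by rewrite otp_image ?otp_setT.
Qed.

(** * Ordinal sums *)

Lemma otp_sum (a b : Ord) (H : set (ord_add a b)) :
  otp H =o otp ((inl : a -> ord_add a b) @^-1` H) +
           otp ((inr : b -> ord_add a b) @^-1` H).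
Proof.
apply: ord_eq_sym.
pose f (u : otp ((inl : a -> ord_add a b) @^-1` H) +
            otp ((inr : b -> ord_add a b) @^-1` H)) : otp H :=
  match u with
  | inl v => @otp_elt (ord_add a b) H (inl (val v)) (otp_eltP v)
  | inr v => @otp_elt (ord_add a b) H (inr (val v)) (otp_eltP v)
  end.
exists f; first by case=> u [v|v].
apply/seteqP; split=> // -[[x|x] Hx] _.
- exists (inl (@otp_elt _ ((inl : a -> ord_add a b) @^-1` H) x (set_mem Hx))) => //.
  exact: val_inj.
- exists (inr (@otp_elt _ ((inr : b -> ord_add a b) @^-1` H) x (set_mem Hx))) => //.
  exact: val_inj.
Qed.

Lemma otp_union (a : Ord) (A B : set a) :
    (forall x y, A x -> B y -> olt x y) ->
  otp (A `|` B) =o otp A + otp B.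
Proof.
move=> AB; apply: ord_eq_sym.
exists (fun u : otp A + otp B => match u with
  | inl v => @otp_elt _ (A `|` B) (val v) (or_introl (otp_eltP v))
  | inr v => @otp_elt _ (A `|` B) (val v) (or_intror (otp_eltP v)) end).
  case=> u [] v //=; have ux := otp_eltP u; have vx := otp_eltP v.
    by apply: ole_olt; exact: AB.
  by apply/negbTE; exact: AB.
apply/seteqP; split=> // u _; have [Au|Bu] := otp_eltP u.
- by exists (inl (otp_elt Au)) => //; exact: val_inj.
- by exists (inr (otp_elt Bu)) => //; exact: val_inj.
Qed.

Lemma seg_tail (a : Ord) (x : a) : a =o seg x + tail x.
Proof.
rewrite -otp_union; last by move=> y z; exact: olt_le_trans.
rewrite -{1}(otp_setT a); suff -> : setT = [set y | olt y x] `|` [set y | ole x y].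
  by [].
by apply/seteqP; split=> // y _; have [xy|yx] := ole_ltP x y; [right | left].
Qed.

Lemma ord_leD (a a' b b' : Ord) : a <=o a' -> b <=o b' -> a + b <=o a' + b'.
Proof.
move=> /ord_leP[f [fm _]] /ord_leP[g [gm _]].
apply: (@mono_ord_le (a + b) (a' + b')
  (fun u => match u with inl x => inl (f x) | inr y => inr (g y) end)).
by case=> x [] y /=; rewrite ?fm ?gm.
Qed.

#[global] Instance ord_add_proper :
  Proper (ord_eq ==> ord_eq ==> ord_eq) ord_add.
Proof.
move=> a a' aa b b' bb.
by apply: ord_le_anti; apply: ord_leD; apply: ord_eq_le => //; apply: ord_eq_sym.
Qed.

Lemma ord_addA (a b c : Ord) : a + (b + c) =o a + b + c.
Proof.
apply: ord_le_anti.
- apply: (@mono_ord_le (a + (b + c)) (a + b + c) (fun u =>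
    match u with inl x => inl (inl x) | inr (inl y) => inl (inr y)
               | inr (inr z) => inr z end)).
  by case=> [x|[x|x]] [y|[y|y]].
- apply: (@mono_ord_le (a + b + c) (a + (b + c)) (fun u =>
    match u with inl (inl x) => inl x | inl (inr y) => inr (inl y)
               | inr z => inr (inr z) end)).
  by case=> [[x|x]|x] [[y|y]|y].
Qed.

Lemma ord_leDl (a b : Ord) : a <=o a + b.
Proof. by apply: (@mono_ord_le a (a + b) inl). Qed.

Lemma ord_leDr (a b : Ord) : b <=o a + b.
Proof. by apply: (@mono_ord_le b (a + b) inr). Qed.

Lemma ord_ltDl (a b : Ord) : nonzero b -> a <o a + b.
Proof.
move=> [y0 _]; have [|y _ ymin] := wo_min (@ole_wo b) (A := setT).
  by exists y0.
exists (inl : a -> ord_add a b) => //; exists (inr y).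
apply/seteqP; split=> [_ [x _ <-]//|[x|z]]; first by exists x.
by rewrite /= /olt /= ymin.
Qed.

Lemma ord_sub_lt (a b : Ord) : a <o b -> exists2 c, nonzero c & b =o a + c.
Proof.
move=> /ord_ltP[x ax]; exists (tail x); last by rewrite ax; exact: seg_tail.
by exists (otp_elt (ole_refl x : [set y | ole x y] x)).
Qed.

Lemma ord_nat0 : ~ nonzero 0%:o.
Proof. by move=> [x _]; have := otp_eltP x. Qed.

Lemma ord_add0 (a b : Ord) : ~ nonzero b -> a + b =o a.
Proof.
move=> b0; have ne (y : b) : False by apply: b0; exists y.
apply: ord_le_anti; last exact: ord_leDl.
apply: (@mono_ord_le (a + b) a
  (fun u => match u with inl x => x | inr y => match ne y with end end)).
by case=> [x|x]; [case=> [y|y] //=; case: (ne y) | case: (ne x)].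
Qed.

Lemma ord_0add (a b : Ord) : ~ nonzero a -> a + b =o b.
Proof.
move=> a0; have ne (y : a) : False by apply: a0; exists y.
apply: ord_le_anti; last exact: ord_leDr.
apply: (@mono_ord_le (a + b) b
  (fun u => match u with inr x => x | inl y => match ne y with end end)).
by case=> [x|x]; [case: (ne x) | case=> [y|y] //=; case: (ne y)].
Qed.

Lemma ord_sub_le (a b : Ord) : a <=o b -> exists c, b =o a + c.
Proof.
move=> [/ord_sub_lt[c _ bE]|ab]; first by exists c.
by exists 0%:o; rewrite ord_add0 -?ab//; exact: ord_nat0.
Qed.

Lemma ord_ltD2l (a b c : Ord) : b <o c -> a + b <o a + c.
Proof. by move=> /ord_sub_lt[d d0 ->]; rewrite ord_addA; exact: ord_ltDl. Qed.

Lemma ord_leD2l (a b c : Ord) : a + b <=o a + c -> b <=o c.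
Proof. by move=> le; apply/ord_leNgt => /(ord_ltD2l a)/ord_ltNge. Qed.

Lemma ord_ltD2l_inv (a b c : Ord) : a + b <o a + c -> b <o c.
Proof.
move=> lt; apply/ord_ltNge => le.
by move: lt => /ord_ltNge; apply; apply: ord_leD => //.
Qed.

Lemma ord_eqD2l (a b c : Ord) : a + b =o a + c -> b =o c.
Proof.
by move=> e; apply: ord_le_anti; apply: (@ord_leD2l a); rewrite e; exact: ord_lexx.
Qed.

(** * Natural numbers and successors *)

Lemma ord_natD (m n : nat) : (m + n)%N%:o =o m%:o + n%:o.
Proof.
apply: ord_eq_sym.
have lt1 (u : m%:o) : (val u < m + n)%N.
  by rewrite (leq_trans (otp_eltP u))// leq_addr.
have lt2 (u : n%:o) : (m + val u < m + n)%N.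
  by rewrite ltn_add2l; exact: (@otp_eltP omega _ u).
exists (fun u : m%:o + n%:o => match u with
  | inl u => @otp_elt omega [set k | (k < m + n)%N] _ (lt1 u)
  | inr u => @otp_elt omega [set k | (k < m + n)%N] _ (lt2 u) end).
  case=> u [] v //=; rewrite /sub_le /=.
  - by rewrite ltnW// (leq_trans (otp_eltP u))// leq_addr.
  - by apply/negbTE; rewrite -ltnNge (leq_trans (otp_eltP v))// leq_addr.
  - by rewrite leq_add2l.
apply/seteqP; split=> // u _; have /= uP := otp_eltP u.
have [um|mu] := ltnP (val u) m.
  by exists (inl (@otp_elt omega [set k | (k < m)%N] _ um)) => //; exact: val_inj.
have um : (val u - m < n)%N by rewrite ltn_subLR.
exists (inr (@otp_elt omega [set k | (k < n)%N] _ um)) => //.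
by apply: val_inj; rewrite /= subnKC.
Qed.

Lemma ord_natS (n : nat) : n.+1%:o =o n%:o + 1%:o.
Proof. by rewrite -addn1; exact: ord_natD. Qed.

Lemma ord_nat_1S (n : nat) : n.+1%:o =o 1%:o + n%:o.
Proof. by rewrite -add1n; exact: ord_natD. Qed.

Lemma ord_addn0 (a : Ord) : a + 0%:o =o a.
Proof. by apply: ord_add0; exact: ord_nat0. Qed.

Lemma ord_add0n (a : Ord) : 0%:o + a =o a.
Proof. by apply: ord_0add; exact: ord_nat0. Qed.

Lemma ord_nat_finite (n : nat) : ~ infinite n%:o.
Proof.
move=> inf; apply: inf; apply: (sub_finite_set (B := val @^-1` `I_n)).
  by move=> u _; exact: (@otp_eltP omega _ u).
by apply: finite_preimage => // u v _ _; exact: val_inj.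
Qed.

Lemma nonzero1 : nonzero 1%:o.
Proof. by exists (@otp_elt omega [set k | (k < 1)%N] 0%N isT). Qed.

Lemma ord_nat1_eq (u v : 1%:o) : u = v.
Proof.
apply: val_inj; have := otp_eltP u; have := otp_eltP v => /=.
by rewrite !ltnS !leqn0 => /eqP-> /eqP->.
Qed.

Lemma ord_le1 (a : Ord) : nonzero a -> 1%:o <=o a.
Proof.
move=> [x _]; apply: (@mono_ord_le _ _ (fun=> x)) => u v.
by rewrite (ord_nat1_eq u v) !ole_refl.
Qed.

Lemma otp_set1 (a : Ord) (x : a) : otp [set x] =o 1%:o.
Proof.
apply: ord_le_anti; last by apply: ord_le1; exists (@otp_elt a [set x] x erefl).
have [e _] := nonzero1; have u0 (u : otp [set x]) : val u = x by exact: otp_eltP u.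
apply: (@mono_ord_le _ _ (fun=> e)) => u v.
by rewrite [LHS]ole_refl /= /sub_le !u0 ole_refl.
Qed.

Lemma ord_ltS (a : Ord) : a <o a + 1%:o.
Proof. by apply: ord_ltDl; exact: nonzero1. Qed.

Lemma ord_lt_leS (a b : Ord) : a <o b -> a + 1%:o <=o b.
Proof.
by move=> /ord_sub_lt[c /ord_le1 c1 ->]; apply: ord_leD => //.
Qed.

Lemma ord_ltSS (a b : Ord) : a <o b -> a + 1%:o <o b + 1%:o.
Proof. by move=> /ord_lt_leS ab; exact: ord_le_lt_trans (ord_ltS b). Qed.

Lemma ord_ltDn (a b : Ord) (n : nat) : a <o b -> a + n%:o <o b + n%:o.
Proof.
move=> ab; elim: n => [|n IH]; first by rewrite !ord_addn0.
by rewrite ord_natS !ord_addA; exact: ord_ltSS.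
Qed.

(** If [a + 1 < 1 + a], then [a + 1] is [1 + b] for some [b < a], and
    [1 + b <= b + 1 <= a] by induction. *)
Lemma ord_1add_le (a : Ord) : 1%:o + a <=o a + 1%:o.
Proof.
elim/ord_least_ind: a => a IH; apply/ord_leNgt => lt.
have /ord_sub_le[b bE] : 1%:o <=o a + 1%:o by exact: ord_leDr.
have ba : b <o a by move: lt; rewrite bE => /ord_ltD2l_inv.
have := ord_le_trans (IH _ ba) (ord_lt_leS ba).
by rewrite -bE => /ord_leNgt; apply; exact: ord_ltS.
Qed.

(** * Limit ordinals *)

(** Zero counts as a limit, so that every ordinal is a limit plus a natural
    number. *)
Definition limit (a : Ord) := forall b, b <o a -> b + 1%:o <o a.

Lemma limit_or_succ (a : Ord) : limit a \/ exists b, a =o b + 1%:o.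
Proof.
have [|/existsNP[b /not_implyP[ba nba]]] := pselect (limit a); first by left.
right; exists b; apply: ord_le_anti; last exact: ord_lt_leS.
exact/ord_leNgt.
Qed.

Lemma limit_natD (a b : Ord) (n : nat) : limit a -> b <o a -> b + n%:o <o a.
Proof.
move=> la ba; elim: n => [|n IH]; first by rewrite ord_addn0.
by rewrite ord_natS ord_addA; exact: la.
Qed.

Lemma limit_nat_lt (a : Ord) (n : nat) : limit a -> nonzero a -> n%:o <o a.
Proof.
move=> la a0; rewrite -(ord_add0n n%:o); apply: limit_natD => //.
apply/ord_ltNge => /nonzero_le/(_ a0); exact: ord_nat0.
Qed.

Lemma ord_limit_nat (a : Ord) : exists l n, limit l /\ a =o l + n%:o.
Proof.
elim/ord_least_ind: a => a IH; have [la|[b ab]] := limit_or_succ a.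
  by exists a, 0%N; split=> //; rewrite ord_addn0.
have [|l [n [ll bE]]] := IH b; first by rewrite ab; exact: ord_ltS.
by exists l, n.+1; split=> //; rewrite ab bE (ord_natS n) ord_addA.
Qed.

(** * Absorption *)

Definition ord_iter (s : Ord) (n : nat) : Ord := iter n (ord_add s) 0%:o.

(** This replaces comparing [a] with the product of [s] and [omega]: a least
    counterexample [a = s + t] would make [t < a] another one. *)
Lemma ord_absorb (s a : Ord) : (forall n, ord_iter s n <=o a) -> s + a =o a.
Proof.
elim/ord_least_ind: a => a IH sa.
apply: ord_le_anti; last exact: ord_leDr; apply/ord_leNgt => asa.
have /ord_sub_le[t at_] : s <=o a.
  by have := sa 1%N; rewrite /ord_iter /= ord_addn0.
have ta : t <o a by move: asa; rewrite {1}at_ => /ord_ltD2l_inv.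
have /(IH _ ta) : forall n, ord_iter s n <=o t.
  by move=> n; apply: (@ord_leD2l s); rewrite -at_; exact: (sa n.+1).
by rewrite -at_ => e; apply: (@ord_ltxx a); rewrite {1}e.
Qed.

Lemma ord_iter1 (n : nat) : ord_iter 1%:o n =o n%:o.
Proof.
elim: n => [|n IH]; first exact: ord_eq_refl.
by rewrite (ord_nat_1S n) -IH.
Qed.

Lemma limit_1add (a : Ord) : limit a -> nonzero a -> 1%:o + a =o a.
Proof.
move=> la a0; apply: ord_absorb => n; rewrite ord_iter1.
by apply: ord_ltW; exact: limit_nat_lt.
Qed.

Lemma limit_nat_add (a : Ord) (n : nat) : limit a -> nonzero a -> n%:o + a =o a.
Proof.
move=> la a0; elim: n => [|n IH]; first exact: ord_add0n.
by rewrite ord_natS -ord_addA limit_1add.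
Qed.

Lemma infinite_limit_nat (a : Ord) : infinite a ->
  exists l n, [/\ limit l, nonzero l & a =o l + n%:o].
Proof.
move=> infa; have [l [n [ll aE]]] := ord_limit_nat a.
exists l, n; split=> //; apply: contrapT => l0.
apply: (@ord_nat_finite n); apply: infinite_le infa.
by rewrite aE ord_0add.
Qed.

Lemma infinite_nonzero (a : Ord) : infinite a -> nonzero a.
Proof.
move=> /infinite_limit_nat[l [n [_ l0 aE]]].
by apply: nonzero_le l0; rewrite aE; exact: ord_leDl.
Qed.

Lemma infinite_1add (a : Ord) : infinite a -> 1%:o + a =o a.
Proof.
by move=> /infinite_limit_nat[l [n [ll l0 ->]]]; rewrite ord_addA limit_1add.
Qed.

Lemma ord_iter_absorbed (s c : Ord) (n : nat) :
  s + c <=o c -> ord_iter s n + c <=o c.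
Proof.
move=> sc; elim: n => [|n IH].
  by rewrite ord_add0n.
rewrite /ord_iter /= -/(ord_iter s n) -ord_addA.
by apply: ord_le_trans sc; apply: ord_leD => //.
Qed.

(** A strict inequality [h + l < g + l] means that [l] fails to absorb the
    difference [s] of [g] and [h], so some finite multiple of [s] exceeds [l].
    If [l + d] absorbed [s], it would absorb twice that multiple, which is
    longer than [l + l] and hence than [l + d]. *)
Lemma ord_ltD_tail (h g l d : Ord) :
  d <=o l -> h <=o g -> h + l <o g + l -> h + (l + d) <o g + (l + d).
Proof.
move=> dl /ord_sub_le[s gE] lt; apply/ord_ltNge => le.
have {}le : s + (l + d) <=o l + d.
  by apply: (@ord_leD2l h); rewrite ord_addA -gE.
have [sl|/existsNP[n /ord_ltNge ln]] := pselect (forall n, ord_iter s n <=o l).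
  by move: lt; rewrite gE -ord_addA (ord_absorb sl); exact: ord_ltxx.
have nle := ord_iter_absorbed n le.
apply: (@ord_ltxx (l + d)).
apply: (@ord_le_lt_trans (l + l)); first by apply: ord_leD => //.
apply: (@ord_lt_le_trans (l + ord_iter s n)); first exact: ord_ltD2l.
apply: (@ord_le_trans (ord_iter s n + (ord_iter s n + (l + d)))).
  by apply: ord_leD; [exact: ord_ltW | exact: ord_leDl].
by apply: (ord_le_trans _ nle); exact: ord_leD.
Qed.

(** * Ordinal products *)

Lemma ord_leM (a a' b b' : Ord) : a <=o a' -> b <=o b' -> a * b <=o a' * b'.
Proof.
move=> /ord_leP[f [fm _]] /ord_leP[g [gm _]].
apply: (@mono_ord_le (a * b) (a' * b') (fun u => (f u.1, g u.2))) => u v.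
by rewrite /= /prod_le /= !fm !gm.
Qed.

#[global] Instance ord_mul_proper :
  Proper (ord_eq ==> ord_eq ==> ord_eq) ord_mul.
Proof.
move=> a a' aa b b' bb.
by apply: ord_le_anti; apply: ord_leM; apply: ord_eq_le => //; apply: ord_eq_sym.
Qed.

Lemma ord_mulDr (a b c : Ord) : a * (b + c) =o a * b + a * c.
Proof.
exists (fun u : a * (b + c) => match u.2 with
  | inl y => inl (u.1, y) | inr z => inr (u.1, z) end).
  by case=> x [y|y] [x' [y'|y']].
apply/seteqP; split=> // -[[x y]|[x y]] _.
- by exists (x, inl y).
- by exists (x, inr y).
Qed.

Lemma ord_mul1 (a : Ord) : a * 1%:o =o a.
Proof.
have [e _] := nonzero1.
exists (fun u : a * 1%:o => u.1).
  case=> x i [y j]; rewrite (ord_nat1_eq i j).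
  by rewrite -[RHS]/(ole j j && (ole j j ==> ole x y)) !ole_refl.
by apply/seteqP; split=> // x _; exists (x, e).
Qed.

Lemma ord_mul_natS (a : Ord) (n : nat) : a * n.+1%:o =o a * n%:o + a.
Proof. by rewrite (ord_natS n) ord_mulDr ord_mul1. Qed.

Lemma ord_mul_nat_1S (a : Ord) (n : nat) : a * n.+1%:o =o a + a * n%:o.
Proof. by rewrite (ord_nat_1S n) ord_mulDr ord_mul1. Qed.

Lemma ord_mul_nonzero (a b : Ord) : nonzero a -> nonzero b -> nonzero (a * b).
Proof. by move=> [x _] [y _]; exists (x, y). Qed.

Lemma ord_mul0 (a : Ord) : ~ nonzero (a * 0%:o).
Proof. by move=> [[x i] _]; apply: ord_nat0; exists i. Qed.

Lemma ord_ltM2l (a b c : Ord) : nonzero a -> b <o c -> a * b <o a * c.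
Proof.
move=> a0 /ord_sub_lt[d d0 ->]; rewrite ord_mulDr.
by apply: ord_ltDl; exact: ord_mul_nonzero.
Qed.

Lemma ord_lt_mul (a b c : Ord) : c <o a * b ->
  exists2 d, d <o b & c <=o a * (d + 1%:o).
Proof.
move=> /ord_ltP[[i x] cE]; exists (seg x); first exact: seg_lt.
pose K : set b := [set y | olt y x] `|` [set x].
rewrite cE; apply: (@ord_le_trans (a * otp K)); last first.
  apply: ord_leM => //; rewrite otp_union; last by move=> y _ yx ->.
  by apply: ord_leD => //; rewrite otp_set1.
have uK (u : @seg (a * b) (i, x)) : K (val u).2.
  have /ole_olt/andP[/= ux _] := otp_eltP u.
  by have [->|] := ole_eqVlt ux; [right | left].
by apply: (@mono_ord_le (@seg (a * b) (i, x)) (a * otp K)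
  (fun u => ((val u).1, otp_elt (uK u)))).
Qed.

Lemma ord_le_of_lt (a b : Ord) : (forall c, c <o a -> c <o b) -> a <=o b.
Proof. by move=> ab; apply/ord_leNgt => /ab/ord_ltxx. Qed.

(** The surplus is zero at limits; at a successor, doubling adds two. *)
Lemma ord_double_le (a : Ord) : exists n : nat, (1%:o + 1%:o) * a <=o a + n%:o.
Proof.
elim/ord_least_ind: a => a IH; have [la|[b ab]] := limit_or_succ a.
  exists 0%N; rewrite ord_addn0; apply: ord_le_of_lt => c.
  move=> /ord_lt_mul[d /la da /ord_le_lt_trans]; apply.
  have [n /ord_le_lt_trans] := IH _ da; apply; exact: limit_natD.
have [|n nP] := IH b; first by rewrite ab; exact: ord_ltS.
exists n.+1; rewrite ab ord_mulDr ord_mul1.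
apply: ord_le_trans (ord_leD nP (ord_lexx _)) _.
rewrite (ord_natS n) -!ord_addA; apply: ord_leD => //.
by rewrite 2!ord_addA -ord_nat_1S -ord_natS.
Qed.

Lemma limit_double (a : Ord) : limit a -> (1%:o + 1%:o) * a =o a.
Proof.
move=> la; apply: ord_le_anti; last first.
  have [e _] := nonzero1.
  apply: (@mono_ord_le a ((1%:o + 1%:o) * a) (fun x => (inl e, x))) => x y.
  by rewrite /= /prod_le /= leqnn implybT andbT.
apply: ord_le_of_lt => c /ord_lt_mul[d /la da /ord_le_lt_trans]; apply.
have [n /ord_le_lt_trans] := ord_double_le (d + 1%:o); apply.
exact: limit_natD.
Qed.

(** * Surjections between ordinals *)

Definition onto (a b : Ord) (r : a -> b) := forall y, exists x, r x = y.

Definition sum_map (a a' b b' : Ord) (f : a -> a') (g : b -> b')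
    (u : ord_add a b) : ord_add a' b' :=
  match u with inl x => inl (f x) | inr y => inr (g y) end.

Lemma sum_map_surjective (a a' b b' : Ord) (f : a -> a') (g : b -> b') :
  onto f -> onto g -> onto (sum_map f g).
Proof.
move=> fs gs [x|y]; first by have [z <-] := fs x; exists (inl z).
by have [z <-] := gs y; exists (inr z).
Qed.

Lemma otp_sum_map (a a' b b' : Ord) (f : a -> a') (g : b -> b')
    (H : set (ord_add a b)) :
  otp (sum_map f g @` H) =o
    otp (f @` ((inl : a -> ord_add a b) @^-1` H)) +
    otp (g @` ((inr : b -> ord_add a b) @^-1` H)).
Proof.
rewrite otp_sum.
suff [-> ->] : inl @^-1` (sum_map f g @` H) = f @` (inl @^-1` H) /\
               inr @^-1` (sum_map f g @` H) = g @` (inr @^-1` H) by [].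
split; apply/seteqP; split=> y.
- by move=> [[x|x] Hx] //= [<-]; exists x.
- by move=> [x Hx <-]; exists (inl x).
- by move=> [[x|x] Hx] //= [<-]; exists x.
- by move=> [x Hx <-]; exists (inr x).
Qed.

Lemma ord_le_surjection (a b : Ord) : nonzero a -> a <=o b ->
  exists r : b -> a, onto r.
Proof.
move=> [x0 _] /ord_leP[f [fm _]].
have ex y : exists x, forall z, f z = y -> z = x.
  have [[x fx]|ny] := pselect (exists x, f x = y); last first.
    by exists x0 => z fz; case: ny; exists z.
  by exists x => z; rewrite -fx; exact: mono_ole_inj.
have [r rP] := choice ex; exists r => x; exists (f x).
exact/esym/rP.
Qed.

(** Writing [a] as two times [a], send the elements in the lower half of their
    pair to one copy of [a] and the others to the other copy: each copy is
    hit in an order-preserving way. *)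
Lemma limit_split (a : Ord) : limit a -> exists r : a -> ord_add a a,
  onto r /\ forall H : set a,
    otp (inl @^-1` (r @` H)) <=o otp H /\ otp (inr @^-1` (r @` H)) <=o otp H.
Proof.
move=> /limit_double/ord_eq_sym/ord_eq_bij[f [g [fm gm fK gK]]].
have [e _] := nonzero1.
pose r x : ord_add a a :=
  match (f x).1 with inl _ => inl (f x).2 | inr _ => inr (f x).2 end.
have rl x y : r x = inl y -> f x = (inl e, y).
  by rewrite /r; case: (f x) => [[i|i] z] //= [->]; rewrite (ord_nat1_eq i e).
have rr x y : r x = inr y -> f x = (inr e, y).
  by rewrite /r; case: (f x) => [[i|i] z] //= [->]; rewrite (ord_nat1_eq i e).
exists r; split.
  by move=> [y|y]; [exists (g (inl e, y)) | exists (g (inr e, y))]; rewrite /r gK.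
have gmono (i : ord_add 1%:o 1%:o) (x y : a) : ole (g (i, x)) (g (i, y)) = ole x y.
  rewrite gm; change (ole x y && (ole y x ==> ole i i) = ole x y).
  by rewrite ole_refl implybT andbT.
move=> H; split.
- apply: (@otp_map _ _ _ _ (fun y => g (inl e, y))) => [y [x Hx /rl fx]|*].
    by rewrite -fx fK.
  exact: gmono.
- apply: (@otp_map _ _ _ _ (fun y => g (inr e, y))) => [y [x Hx /rr fx]|*].
    by rewrite -fx fK.
  exact: gmono.
Qed.

(** * Cofinality *)

Lemma ord_leastP (P : Ord -> Prop) (P0 : exists a, P a) :
  P (ord_least P0) /\ forall b, P b -> ord_least P0 <=o b.
Proof. exact: (svalP (cid (ex_ord_least P0))). Qed.

Lemma cf_le (a : Ord) (H : set a) : cofinal H -> cf a <=o otp H.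
Proof. by move=> cH; apply: (ord_leastP (ex_cofinal_type a)).2; exists H. Qed.

Lemma cf_cofinal (a : Ord) : exists2 H : set a, cofinal H & cf a =o otp H.
Proof.
have [[H cH e] _] := ord_leastP (ex_cofinal_type a).
by exists H => //; rewrite /cf e.
Qed.

(** The map need not be increasing: it is so on the indices where it exceeds all
    its previous values, and these values are still cofinal. *)
Lemma cf_le_map (l a : Ord) (s : l -> a) :
  (forall x, exists i, ole x (s i)) -> cf a <=o l.
Proof.
move=> sc; pose I := [set i : l | forall j, olt j i -> olt (s j) (s i)].
have cI : cofinal (s @` I).
  move=> x; have [|i xi imin] := wo_min (@ole_wo l) (A := [set i | ole x (s i)]).
    exact: sc.
  exists (s i) => //; exists i => // j ji.
  apply: olt_le_trans xi; have [xj|//] := ole_ltP x (s j).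
  by move: ji; rewrite /olt (imin j xj).
apply: ord_le_trans (cf_le cI) _; rewrite otp_image; first exact: otp_le.
by apply: olt_mono => i j _ Ij; exact: Ij.
Qed.

Lemma cf_le_tail (a b c : Ord) : nonzero c -> a =o b + c -> cf a <=o c.
Proof.
move=> [c0 _] /ord_eq_bij[f [g [fm gm fK gK]]].
apply: (@cf_le_map _ _ (fun y => g (inr y))) => x.
case fx : (f x) => [y|y]; [exists c0 | exists y];
  by rewrite -fm gK fx //= ole_refl.
Qed.

(** * Cardinals *)

Lemma succ_card_le (l k : Ord) : cardinal k -> l <o k -> succ_card l <=o k.
Proof. by move=> ck lk; exact: (ord_leastP (ex_larger_cardinal l)).2. Qed.

Lemma card_le_injective (a b : Ord) (f : a -> b) :
  injective f -> ([set: a] #<= [set: b])%card.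
Proof.
move=> fi; apply: (@card_le_trans _ _ _ (f @` setT)); last exact: subset_card_le.
have : (f @` setT #= [set: a])%card by apply: inj_card_eq => x y _ _; exact: fi.
by rewrite card_eq_le => /andP[].
Qed.

(** The initial ordinal equipotent to [d] is a cardinal at most [d], hence not
    above [l]. *)
Lemma succ_card_surjection (l d : Ord) : nonzero d -> d <o succ_card l ->
  exists r : l -> d, onto r.
Proof.
move=> d0 dl.
have [|k [kd kmin]] := @ex_ord_least (fun k => [set: k] #= [set: d])%card.
  by exists d; exact: card_eqxx.
have ck : cardinal k.
  move=> c ck; apply/negP => clk; apply: (ord_lt_le_irrefl ck).
  by apply: kmin; exact: card_eq_trans clk kd.
have kled : k <=o d by apply: kmin; exact: card_eqxx.
have /card_bijP[f [f' _ fK]] := kd.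
have inT (T : Type) (x : T) : x \in [set: T] by exact: mem_set.
pose q x : d := val (f (SigSub (inT k x))).
have qs : onto q.
  move=> y; exists (val (f' (SigSub (inT d y)))); rewrite /q.
  have -> : SigSub (inT k (val (f' (SigSub (inT d y))))) = f' (SigSub (inT d y)).
    exact: val_inj.
  by rewrite fK.
have k0 : nonzero k by have [y _] := d0; have [x _] := qs y; exists x.
have kl : k <=o l.
  apply/ord_leNgt => lk; apply: (ord_lt_le_irrefl dl).
  exact: ord_le_trans (succ_card_le ck lk) kled.
have [r rs] := ord_le_surjection k0 kl.
by exists (q \o r) => y; have [x <-] := qs y; have [z <-] := rs x; exists z.
Qed.

Lemma card_image_lt (l d : Ord) (r : l -> d) (H : set l) :
  cardinal l -> otp H <o l -> otp (r @` H) <o l.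
Proof.
move=> cl Hl; apply/ord_ltNge => /ord_leP[f [fm _]].
have pre (u : otp (r @` H)) : exists x : otp H, r (val x) = val u.
  by have [x Hx fx] := otp_eltP u; exists (otp_elt Hx).
have [h hP] := choice pre.
have /negP := cl _ Hl; apply; rewrite card_eq_le; apply/andP; split.
  by have [g gm _] := Hl; apply: (card_le_injective (mono_ole_inj gm)).
apply: (@card_le_injective _ _ (h \o f)).
apply: inj_comp; last exact: mono_ole_inj fm.
by move=> u v huv; apply: val_inj; rewrite -!hP huv.
Qed.

(** * Transfer of compactness along surjections *)

Section Transfer.
Variables (X : Type) (tau : set (set X)).
Hypothesis X0 : [set: X] !=set0.

(** Pulling a cover back along a surjection [r] turns it into a cover of length
    [a]. Injectivity is not required, which leaves freedom in the choice of
    [r]; all that matters is how much [r] can lengthen a small set. *)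
Lemma compact_reindex (b a k : Ord) (r : a -> k) (O : k -> set X) :
    ord_compact tau b a -> (forall d, tau (O d)) -> \bigcup_d O d = setT ->
    onto r ->
  exists2 H : set a, otp H <o b & \bigcup_(d in r @` H) O d = setT.
Proof.
move=> ba tO cO rs; have [||H Hb cH] := ba (O \o r).
- by move=> d; exact: tO.
- rewrite -cO; apply/seteqP; split=> x [d _ Od]; first by exists (r d).
  by have [c cd] := rs d; exists c; rewrite //= cd.
- by exists H => //; rewrite bigcup_image.
Qed.

Lemma compact_weaken (b b' a : Ord) :
  b <=o b' -> ord_compact tau b a -> ord_compact tau b' a.
Proof.
move=> bb ba O tO cO; have [H Hb cH] := ba O tO cO.
by exists H => //; exact: ord_lt_le_trans bb.
Qed.

#[local] Instance ord_compact_proper :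
  Proper (ord_eq ==> ord_eq ==> iff) (@ord_compact X tau).
Proof.
have imp b b' a a' : b =o b' -> a =o a' ->
    ord_compact tau b a -> ord_compact tau b' a'.
  move=> bb /ord_eq_bij[f [g [fm _ _ gK]]] ba O tO cO.
  have [|H Hb cH] := compact_reindex ba tO cO (r := f).
    by move=> y; exists (g y).
  by exists (f @` H) => //; rewrite otp_image// -bb.
by move=> b b' bb a a' aa; split; apply: imp => //; exact: ord_eq_sym.
Qed.

(** A cover indexed by a set of type at most [a] becomes a cover of length [a]
    by repeating its first member at the end. If that repeated member gets
    chosen, moving it from the end to the front does not lengthen the subcover,
    since [1 + c <= c + 1]. *)
Lemma compact_shrink (b a k : Ord) (O : k -> set X) (K : set k) :
    ord_compact tau b a -> (forall d, tau (O d)) ->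
    \bigcup_(d in K) O d = setT -> otp K <=o a ->
  exists2 H : set k, otp H <o b & \bigcup_(d in H) O d = setT.
Proof.
move=> ba tO cK /ord_leP[e [em ei]].
have [k0 Kk0 k0min] : exists2 k0, K k0 & forall x, K x -> ole k0 x.
  apply: (wo_min (@ole_wo k)); have [x _] := X0.
  by have [d Kd _] : (\bigcup_(d in K) O d) x by [rewrite cK]; exists d.
have ex x : exists c, (exists2 u, e u = x & c = val u) \/ (~ range e x /\ c = k0).
  have [[u _ ux]|nx] := pselect (range e x); last by exists k0; right.
  by exists (val u); left; exists u.
have [r rP] := choice ex.
have rE u : r (e u) = val u.
  have [[v /(mono_ole_inj em) -> //]|[nr _]] := rP (e u).
  by case: nr; exists u.
have [||H Hb cH] := ba (O \o r).
- by move=> d; exact: tO.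
- apply/seteqP; split=> // x _.
  have [d Kd Od] : (\bigcup_(d in K) O d) x by rewrite cK.
  by exists (e (otp_elt Kd)); rewrite //= rE.
exists (r @` H); last by rewrite bigcup_image.
apply: ord_le_lt_trans Hb.
pose H1 := H `&` range e.
have tH1 : otp (r @` H1) =o otp H1.
  by apply: otp_image => _ _ [_ [u _ <-]] [_ [v _ <-]]; rewrite !rE em.
have [[h [Hh nh] nk0]|small] :=
  pselect (exists2 h, H h /\ ~ range e h & ~ (r @` H1) k0); last first.
  apply: (@ord_le_trans (otp (r @` H1))).
    apply: otp_sub => _ [d Hd <-].
    have [ed|nd] := pselect (range e d); first by exists d.
    have [[u ud]|[_ ->]] := rP d; first by case: nd; exists u.
    by apply: contrapT => nk0; apply: small; exists d.
  by rewrite tH1; apply: otp_sub => d [].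
apply: (@ord_le_trans (otp ([set k0] `|` r @` H1))).
  apply: otp_sub => _ [d Hd <-].
  have [ed|nd] := pselect (range e d); first by right; exists d.
  by left; have [[u ud]|[_ ->]] := rP d; first by case: nd; exists u.
rewrite otp_union; last first.
  move=> _ y -> [d [Hd [u _ du]]]; rewrite -du rE => uy.
  have [k0E|//] := ole_eqVlt (k0min (val u) (otp_eltP u)); last by rewrite -uy.
  by case: nk0; exists (e u); [split; [rewrite du | exists u] | rewrite rE k0E].
rewrite otp_set1 tH1; apply: ord_le_trans (ord_1add_le _) _.
rewrite -(otp_set1 h) -otp_union; last first.
  move=> x _ [_ [u _ <-]] ->; have [/ei//|//] := ole_ltP h (e u).
by apply: otp_sub => d [[]|->].
Qed.

Lemma compact_le (b a a' : Ord) :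
  ord_compact tau b a -> a' <=o a -> ord_compact tau b a'.
Proof.
by move=> ba aa O tO cO; apply: (compact_shrink ba tO cO); rewrite otp_setT.
Qed.

(** Take a subcover of least order type [k]. If [k <= a] it can be shrunk below
    [b]; otherwise [k]-indexed covers can be shortened, against minimality. *)
Lemma compact_descent (b a a' : Ord) :
    ord_compact tau b a ->
    (forall k, a <o k -> k <=o a' -> ord_compact tau k k) ->
  ord_compact tau b a'.
Proof.
move=> ba kk O tO cO.
have [|k [[K -> cK] Kmin]] := @ex_ord_least (fun k =>
    exists2 K : set a', k = otp K & \bigcup_(d in K) O d = setT).
  by exists (otp [set: a']), setT.
have [/(compact_shrink ba tO cK)//|aK] := ord_le_total (otp K) a.
have [||H HK cH] := kk _ aK (otp_le K) (O \o val).
- by move=> d; exact: tO.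
- rewrite -cK; apply/seteqP; split=> x [d Kd Od]; last by exists (otp_elt Kd).
  by exists (val d) => //; exact: otp_eltP d.
have /ord_leNgt[] : otp K <=o otp (val @` H); last by rewrite otp_image.
by apply: Kmin; exists (val @` H); rewrite ?bigcup_image.
Qed.

(** * Lengthening a cover at the end of an initial part *)

(** Cover the longer sequence through the map that spreads the block [l] over
    [l + d] by [r] and keeps all other indices. A small set of indices leaves
    out something in one of the blocks [g], [l], [n]. If it has type less than
    [n] in the last block, this deficit survives, being final. If it has type
    less than [l] in the block [l], the hypothesis on [r] applies. Otherwise
    the deficit lies in [g] and is not absorbed by [l], and [ord_ltD_tail] says
    that [l + d] does not absorb it either. *)
Lemma compact_insert (g l d : Ord) (n : nat) (r : l -> ord_add l d) :
    d <=o l -> onto r ->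
    (forall H, otp H <o l -> otp (r @` H) <o l + d) ->
    ord_compact tau (g + (l + n%:o)) (g + (l + n%:o)) ->
  ord_compact tau (g + (l + d + n%:o)) (g + (l + d + n%:o)).
Proof.
move=> dl rs rl gl O tO cO.
have fs : onto (sum_map (@id g) (sum_map r (@id n%:o))).
  apply: sum_map_surjective; first by move=> x; exists x.
  by apply: sum_map_surjective => // x; exists x.
have [H Hlt cH] := compact_reindex gl tO cO fs.
exists (sum_map (@id g) (sum_map r (@id n%:o)) @` H) => //.
move: Hlt; rewrite !otp_sum_map !image_id (otp_sum H) (otp_sum (_ @^-1` H)).
set h0 := otp (inl @^-1` H); set h1 := inl @^-1` _.
set h2 := otp (inr @^-1` _) => Hlt.
have h0g : h0 <=o g by exact: otp_le.
have rh : otp (r @` h1) <=o l + d by exact: otp_le.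
have [h2n|n2] := ord_le_total n%:o h2; last first.
  apply: (@ord_le_lt_trans (g + (l + d + h2))).
    by apply: ord_leD => //; exact: ord_leD.
  by do 2!apply: ord_ltD2l.
have {}h2n : h2 =o n%:o by apply: ord_le_anti => //; exact: otp_le.
move: Hlt; rewrite h2n 2!ord_addA => Hlt.
have {}Hlt : h0 + otp h1 <o g + l.
  apply/ord_ltNge => le; apply: (ord_lt_le_irrefl Hlt).
  exact: ord_leD.
rewrite 2!ord_addA; apply: ord_ltDn.
have [lh|h1l] := ord_le_total l (otp h1); last first.
  apply: (@ord_le_lt_trans (g + otp (r @` h1))); first exact: ord_leD.
  by apply: ord_ltD2l; exact: rl.
apply: (@ord_le_lt_trans (h0 + (l + d))); first exact: ord_leD.
apply: ord_ltD_tail => //; apply: ord_le_lt_trans Hlt.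
exact: ord_leD.
Qed.

Lemma compact_insert0 (g l d : Ord) (r : l -> ord_add l d) :
    d <=o l -> onto r ->
    (forall H, otp H <o l -> otp (r @` H) <o l + d) ->
  ord_compact tau (g + l) (g + l) -> ord_compact tau (g + (l + d)) (g + (l + d)).
Proof.
move=> dl rs rl; have := compact_insert (g := g) (n := 0%N) dl rs rl.
by rewrite !ord_addn0.
Qed.

(** An infinite [a] is [1 + a]; the index taken from the front serves the new
    last member of the cover. *)
Lemma compact_succ (b a : Ord) :
    b <=o a -> infinite a -> ord_compact tau b a ->
  ord_compact tau b (a + 1%:o).
Proof.
move=> ba infa cba; apply: (compact_descent cba) => k /ord_lt_leS ak ka.
have -> : k =o 0%:o + (a + 1%:o).
  by rewrite ord_add0n; exact: ord_le_anti.
have [f [f' [fm f'm fK f'K]]] := ord_eq_bij (ord_eq_sym (infinite_1add infa)).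
pose r x : ord_add a 1%:o := match f x with inl u => inr u | inr y => inl y end.
apply: (@compact_insert0 _ _ _ r).
- by apply: ord_le1; exact: infinite_nonzero.
- by move=> [y|u]; [exists (f' (inr y)) | exists (f' (inl u))]; rewrite /r f'K.
- move=> H Ha; rewrite otp_sum; apply: (@ord_le_lt_trans (otp H + 1%:o)).
    apply: ord_leD; last exact: otp_le.
    apply: (@otp_map _ _ _ _ (fun y => f' (inr y))) => [y [x Hx]|x y _ _].
      by rewrite /r; case fx : (f x) => //= -[<-]; rewrite -fx fK.
    by rewrite f'm.
  exact: ord_ltSS.
- by rewrite ord_add0n; exact: compact_weaken ba cba.
Qed.



Lemma compact_natD (b a : Ord) (n : nat) :
    b <=o a -> infinite a -> ord_compact tau b a ->
  ord_compact tau b (a + n%:o).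
Proof.
move=> ba infa cba; elim: n => [|n IH]; first by rewrite ord_addn0.
rewrite (ord_natS n) ord_addA; apply: compact_succ => //.
- exact: ord_le_trans ba (ord_leDl _ _).
- exact: infinite_le (ord_leDl _ _) infa.
Qed.

(** With [a = l + n] for a limit [l], the sum [a + a] is [l + l + n], because
    [l] absorbs the [n] in the middle: only the limit part has to be doubled. *)
Lemma compact_double (g a : Ord) :
    infinite g \/ infinite a ->
    ord_compact tau (g + a) (g + a) ->
  ord_compact tau (g + a + a) (g + a + a).
Proof.
move=> inf; have [l [n [ll aE]]] := ord_limit_nat a.
have [l0|l0] := pselect (nonzero l); last first.
  have {}aE : a =o n%:o by rewrite aE ord_0add.
  have infg : infinite g.
    case: inf => // infa; case: (@ord_nat_finite n).
    by apply: infinite_le infa; right.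
  rewrite aE => cg; apply: (@compact_weaken (g + n%:o)); first exact: ord_leDl.
  apply: compact_natD => //; exact: infinite_le (ord_leDl _ _) infg.
have -> : g + a + a =o g + (l + l + n%:o).
  by rewrite aE -!ord_addA (ord_addA n%:o l) limit_nat_add.
have [r [rs rH]] := limit_split ll.
rewrite aE; apply: (compact_insert _ rs) => // H Hl.
rewrite otp_sum; have [rl rr] := rH H.
apply: ord_le_lt_trans (ord_leD rl rr) _.
by apply: ord_le_lt_trans (ord_ltD2l _ Hl); apply: ord_leD => //; exact: ord_ltW.
Qed.

Lemma compact_mul_nat (g a : Ord) (n : nat) :
    infinite g \/ infinite a ->
    ord_compact tau (g + a) (g + a) ->
  ord_compact tau (g + a * n.+1%:o) (g + a * n.+1%:o).
Proof.
move=> inf ga; elim: n => [|n IH]; first by rewrite ord_mul1.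
move: IH; rewrite (ord_mul_natS a n.+1) (ord_mul_natS a n) !ord_addA.
apply: compact_double; case: inf => [infg|]; last by right.
by left; exact: infinite_le (ord_leDl _ _) infg.
Qed.

(** * Additively indecomposable tails *)

(** The nonzero indecomposable ordinals are the powers of [omega]; absorbing all
    smaller ordinals on the left is the property that is used. *)
Definition indecomposable (a : Ord) := forall b, b <o a -> b + a =o a.

(** The least nonzero tail of [a], which is the last term of its Cantor normal
    form. *)
Lemma indecomposable_tail (a : Ord) : nonzero a ->
  exists b c, [/\ indecomposable c, nonzero c & a =o b + c].
Proof.
move=> a0; have [|c [[c0 [b aE]] cmin]] :=
    @ex_ord_least (fun c => nonzero c /\ exists b, a =o b + c).
  by exists a; split=> //; exists 0%:o; rewrite ord_add0n.
exists b, c; split=> // d dc; have [e e0 cE] := ord_sub_lt dc.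
suff ec : e =o c by apply: ord_eq_sym; apply: (ord_eq_trans cE); rewrite ec.
apply: ord_le_anti; first by rewrite cE; exact: ord_leDr.
by apply: cmin; split=> //; exists (b + d); rewrite aE cE ord_addA.
Qed.

Lemma indecomposable_limit_or_1 (c : Ord) : indecomposable c -> nonzero c ->
  limit c \/ c =o 1%:o.
Proof.
move=> ic c0; have [|[b cE]] := limit_or_succ c; first by left.
right; have bc : b <o c by rewrite cE; exact: ord_ltS.
have := ic _ bc; rewrite {2}cE; exact: ord_eqD2l.
Qed.

(** For [0 < d <= c], doubling [c] and collapsing the second copy onto [d] maps
    a set of type [h < c] to one of type at most [h + d <= c < c + d]. When [c]
    is [1] there is no room inside the tail, and the extra index comes from the
    front. *)
Lemma compact_tail_double (b a c : Ord) :
    indecomposable c -> nonzero c -> infinite (a + c) -> b <=o a + c ->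
    ord_compact tau b (a + c) ->
  ord_compact tau b (a + c + c).
Proof.
move=> ic c0 infac bac cb.
have [lc|c1] := indecomposable_limit_or_1 ic c0; last first.
  by rewrite {2}c1; exact: compact_succ.
apply: (compact_descent cb) => k /[dup] acltk /ord_sub_lt[d d0 kE] kle.
have dc : d <=o c by move: kle; rewrite kE; exact: ord_leD2l.
have [r [rs rH]] := limit_split lc.
have [q qs] := ord_le_surjection d0 dc.
pose s := sum_map (@id c) q \o r.
have -> : k =o a + (c + d) by rewrite kE ord_addA.
apply: (compact_insert0 (r := s)) => //.
- move=> y; have [u <-] : exists u, sum_map (@id c) q u = y.
    by apply: sum_map_surjective => // x; exists x.
  by have [x <-] := rs u; exists x.
- move=> H Hc; rewrite /s -image_comp otp_sum_map image_id.
  apply: (@ord_le_lt_trans (otp H + d)).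
    by apply: ord_leD; [exact: (rH H).1 | exact: otp_le].
  apply: (@ord_le_lt_trans (otp H + c)); first exact: ord_leD.
  by rewrite ic//; exact: ord_ltDl.
- exact: compact_weaken bac cb.
Qed.

Lemma compact_tail_mul (b a c : Ord) (n : nat) :
    indecomposable c -> nonzero c -> infinite (a + c) -> b <=o a + c ->
    ord_compact tau b (a + c) ->
  ord_compact tau b (a + c + c * n%:o).
Proof.
move=> ic c0; elim: n a => [|n IH] a infac bac cb.
  by rewrite (ord_add0 _ (@ord_mul0 c)).
rewrite (ord_mul_nat_1S c n) ord_addA; apply: IH.
- exact: infinite_le (ord_leDl _ _) infac.
- exact: ord_le_trans bac (ord_leDl _ _).
- exact: compact_tail_double.
Qed.

(** A cofinal set can be found inside any nonzero tail of [a], so the cofinality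
    is at most the least tail [c], and the statement holds with [c] in place of
    [l]. *)
Lemma compact_cf (a b l : Ord) :
    b <=o a -> infinite a -> l =o cf a -> ord_compact tau b a ->
  ord_compact_below tau b (a + l * omega).
Proof.
move=> ba infa lE cba k _ ka.
have [ka'|/ord_ltW/ord_sub_le[d kE]] := ord_le_total k a.
  exact: compact_le cba ka'.
have [m dm] : exists m : nat, d <=o l * m%:o.
  have /ord_lt_mul[e /ord_ltP[j eE]] : d <o l * omega.
    by move: ka; rewrite kE; exact: ord_ltD2l_inv.
  move=> /ord_le_trans de; exists j.+1; rewrite (ord_natS j); apply: de.
  apply: ord_leM => //; apply: ord_leD => //; rewrite eE; apply: otp_sub => y.
  by rewrite /olt /= -ltnNge.
have [a' [c [ic c0 aE]]] := indecomposable_tail (infinite_nonzero infa).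
have lc : l <=o c by rewrite lE; exact: cf_le_tail aE.
apply: (@compact_le _ (a' + c + c * m%:o)); last first.
  by rewrite kE aE; apply: ord_leD => //; apply: ord_le_trans dm _; exact: ord_leM.
apply: compact_tail_mul => //; last by rewrite -aE.
  by apply: infinite_le infa; right.
by rewrite -aE.
Qed.

(** * Cardinality *)

(** Cardinality alone bounds the image of a small set: a set of fewer than [l]
    indices has fewer than [l] images, hence order type below [l]. *)
Lemma compact_succ_card (b l : Ord) :
    cardinal l -> b <=o l -> ord_compact tau b l ->
  ord_compact_below tau b (succ_card l).
Proof.
move=> cl bl cb k k0 kl O tO cO.
have [r rs] := succ_card_surjection k0 kl.
have [H Hb cH] := compact_reindex cb tO cO rs.
apply: (compact_shrink cb tO cH); apply: ord_ltW; apply: card_image_lt => //.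
exact: ord_lt_le_trans bl.
Qed.

(** If [b + d] reached [a], then a tail of [a] would have at most [l] elements,
    and so would a cofinal set. *)
Lemma cf_closed (l a b d : Ord) :
  l <o cf a -> b <o a -> d <o succ_card l -> b + d <o a.
Proof.
move=> la /ord_sub_lt[e e0 aE] dl; apply/ord_ltNge => ad.
have ed : e <=o d by move: ad; rewrite aE; exact: ord_leD2l.
have [r rs] := succ_card_surjection e0 (ord_le_lt_trans ed dl).
have [f [g [fm gm fK gK]]] := ord_eq_bij aE.
have [e1 _] := e0.
apply: (ord_lt_le_irrefl la).
apply: (@cf_le_map _ _ (fun i => g (inr (r i)))) => x.
case fx : (f x) => [y|y].
  by have [i ri] := rs e1; exists i; rewrite -fm gK fx.
by have [i ri] := rs y; exists i; rewrite -fm gK fx ri /= ole_refl.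
Qed.

(** A small set of indices either fills [a], and then meets [l] in fewer than
    [l] points, or has type [h < a] in [a], and then no set of type at most [d]
    can bring it up to [a]. *)
Lemma compact_add_succ_card (b a l : Ord) :
    cardinal l -> b <=o a + l ->
    (forall h d, h <o a -> d <o succ_card l -> h + d <o a) ->
    ord_compact tau b (a + l) ->
  ord_compact_below tau b (a + succ_card l).
Proof.
move=> cl bal acl cb k _ ka.
have [kl|lk] := ord_le_total k (a + l); first exact: compact_le cb kl.
have /ord_sub_lt[d d0 kE] := ord_le_lt_trans (ord_leDl a l) lk.
have dl : d <o succ_card l by move: ka; rewrite kE; exact: ord_ltD2l_inv.
rewrite kE => O tO cO; have [r rs] := succ_card_surjection d0 dl.
have [|H Hb cH] := compact_reindex cb tO cO (r := sum_map (@id a) r).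
  by apply: sum_map_surjective => // x; exists x.
apply: (compact_shrink cb tO cH); rewrite otp_sum_map image_id.
have := ord_lt_le_trans Hb bal; rewrite otp_sum.
set h := otp (inl @^-1` H) => hl.
have [ah|ha] := ord_le_total a h.
  apply: ord_leD; first exact: otp_le.
  apply: ord_ltW; apply: card_image_lt => //; apply: (@ord_ltD2l_inv a).
  by apply: ord_le_lt_trans hl; exact: ord_leD.
apply: ord_ltW; apply: ord_lt_le_trans (ord_leDl _ _).
apply: acl => //; apply: ord_le_lt_trans dl; exact: otp_le.
Qed.

(** * Families closed under unions *)

Hypothesis tauU : union_closed tau.

Lemma union_closed_bigcup (I : Type) (D : set I) (O : I -> set X) :
  (forall i, tau (O i)) -> tau (\bigcup_(i in D) O i).
Proof.
move=> tO; rewrite -[\bigcup_(i in D) O i](bigcup_image D O id); apply: tauU.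
by move=> _ [i _ <-].
Qed.

(** Each index [x] gathers the members of the cover with index in [S x] into a
    single one, which belongs to [tau] by closure under unions. *)
Lemma compact_gather (a b k : Ord) (S : a -> set k) :
    ord_compact tau b a -> (forall u, exists x, S x u) ->
  forall O : k -> set X, (forall d, tau (O d)) -> \bigcup_d O d = setT ->
  exists2 H : set a, otp H <o b &
    \bigcup_(u in \bigcup_(x in H) S x) O u = setT.
Proof.
move=> ba Scov O tO cO.
have [||H Hb cH] := ba (fun x => \bigcup_(u in S x) O u).
- by move=> x; exact: union_closed_bigcup.
- rewrite -cO; apply/seteqP; split=> x [u]; first by move=> _ [v _ Ov]; exists v.
  by have [y Syu] := Scov u; exists y => //; exists u.
- by exists H => //; rewrite bigcup_bigcup.
Qed.

(** All of the initial block [b] is attached to every index in [a]. *)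
Lemma compact_add_left (a b : Ord) : nonzero a ->
  ord_compact tau a a -> ord_compact tau (b + a) (b + a).
Proof.
move=> [x0 _] aa O tO cO.
pose S x : set (ord_add b a) :=
  [set u | match u with inl _ => True | inr y => y = x end].
have [|H Ha cH] := compact_gather (S := S) aa _ tO cO.
  by move=> [y|y]; [exists x0 | exists y].
exists (\bigcup_(x in H) S x) => //; rewrite otp_sum.
apply: (@ord_le_lt_trans (b + otp H)); last exact: ord_ltD2l.
apply: ord_leD; first exact: otp_le.
by apply: otp_sub => y [x Hx /= ->].
Qed.

(** Each copy of [b] is gathered as a whole. *)
Lemma compact_mul_left (a b : Ord) : nonzero b ->
  ord_compact tau a a -> ord_compact tau (b * a) (b * a).
Proof.
move=> b0 aa O tO cO.
have [|H Ha cH] :=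
    compact_gather (S := fun x => [set u : ord_mul b a | u.2 = x]) aa _ tO cO.
  by move=> u; exists u.2.
pose K : set (ord_mul b a) := \bigcup_(x in H) [set u | u.2 = x].
exists K => //; apply: (@ord_le_lt_trans (b * otp H)); last exact: ord_ltM2l.
have inH (u : otp K) : H (val u).2 by have [x Hx /= ->] := otp_eltP u.
by apply: (@mono_ord_le (otp K) (b * otp H)
  (fun u => ((val u).1, otp_elt (inH u)))).
Qed.

(** Gathering the initial segments below a cofinal sequence of type [n], fewer
    than [n] of them are bounded in [a], by minimality of the cofinality. *)
Lemma compact_of_cf (a n : Ord) :
  cf a =o n -> ord_compact tau n n -> ord_compact tau a a.
Proof.
move=> an nn; have [C cC cfC] := cf_cofinal a.
have /ord_eq_bij[f [g [fm gm fK gK]]] : n =o otp C by rewrite -an.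
move=> O tO cO.
have [|H Hn cH] :=
    compact_gather (S := fun x => [set u | ole u (val (f x))]) nn _ tO cO.
  by move=> u; have [y Cy uy] := cC u; exists (g (otp_elt Cy)); rewrite /= gK.
exists (\bigcup_(x in H) [set u | ole u (val (f x))]) => //.
have ncof : ~ cofinal ((fun x => val (f x)) @` H).
  move=> /cf_le; rewrite an otp_image; first exact: ord_lt_le_irrefl.
  by move=> x y _ _; rewrite -fm.
move: ncof => /existsNP[x xP].
apply: (ord_le_lt_trans _ (seg_lt x)); apply: otp_sub => u [y Hy /= uy].
have [xy|] := ole_ltP x (val (f y)); last exact: ole_lt_trans.
by case: xP; exists (val (f y)) => //; exists y.
Qed.

End Transfer.

Theorem corollary2p6 (alpha beta gamma lambda nu : Ord)
    (X : Type) (tau : set (set X)) :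
  nonzero alpha -> nonzero beta -> nonzero gamma ->
  nonzero lambda -> cardinal lambda -> nonzero nu -> cardinal nu ->
  [set: X] !=set0 -> tau !=set0 ->
  [/\ (* (1) *)
      beta <=o alpha -> infinite alpha ->
      ord_compact tau beta alpha ->
        ord_compact tau beta (alpha + 1%:o) /\
        (forall n : nat, ord_compact tau beta (alpha + n%:o)),
      (* (2) *)
      infinite gamma \/ infinite alpha ->
      ord_compact tau (gamma + alpha) (gamma + alpha) ->
        ord_compact tau (gamma + alpha + alpha) (gamma + alpha + alpha) /\
        (forall n : nat, (1 <= n)%N ->
          ord_compact tau (gamma + alpha * n%:o) (gamma + alpha * n%:o)),
      (* (3) *)
      beta <=o alpha -> infinite alpha -> lambda =o cf alpha ->
      ord_compact tau beta alpha ->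
        ord_compact_below tau beta (alpha + lambda * omega),
      (* (4) *)
      beta <=o lambda ->
      ord_compact tau beta lambda ->
        ord_compact_below tau beta (succ_card lambda)
    & (* (5) *)
      beta <=o alpha + lambda ->
      lambda <o cf alpha \/
        (exists2 A : Ord -> Prop, limit_of A alpha &
           forall d, A d -> lambda <o cf d) ->
      ord_compact tau beta (alpha + lambda) ->
        ord_compact_below tau beta (alpha + succ_card lambda)] /\
  (union_closed tau ->
   [/\ (* (6) *)
       ord_compact tau alpha alpha ->
         ord_compact tau (beta + alpha) (beta + alpha),
       (* (7) *)
       ord_compact tau alpha alpha ->
         ord_compact tau (beta * alpha) (beta * alpha)
     & (* (8) *)
       cf alpha =o nu -> infinite nu ->
       ord_compact tau nu nu -> ord_compact tau alpha alpha]).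
Proof.
move=> a0 b0 _ _ cl _ _ X0 _; split=> [|tauU]; split.
- move=> ba infa cba; have nD n := compact_natD (n := n) X0 ba infa cba.
  by split=> // ; exact: nD.
- move=> inf cga; split; first exact: compact_double.
  by case=> // n _; exact: compact_mul_nat.
- exact: compact_cf.
- exact: compact_succ_card.
- move=> bal acf; apply: compact_add_succ_card => // h d ha dl.
  case: acf => [lcf|[A [Aa acof] lA]]; first exact: cf_closed lcf ha dl.
  have [e Ae he] := acof _ ha.
  exact: ord_lt_trans (cf_closed (lA _ Ae) he dl) (Aa _ Ae).
- exact: compact_add_left.
- exact: compact_mul_left.
- by move=> an _; exact: compact_of_cf.
Qed.
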